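(* Let $a,b,c\in\mathbb{C}$. For $t>0$ let $S_t=\begin{pmatrix} a & t\\ ct & b\end{pmatrix}\in M_2(\mathbb{C})$. For every $d>0$ let $$E_d=\bigcup_{t\in(0,d)}W(S_t).$$ Then, for every $d>0$, $\overline{E_d}=W(S_d)$. Furthermore, the following statements hold, where $$\lambda_1(d)=\frac{a+b+\sqrt{(a-b)^2+4cd^2}}{2},\qquad \lambda_2(d)=\frac{a+b-\sqrt{(a-b)^2+4cd^2}}{2},$$ $$b_d=\frac{1}{2\sqrt2}\sqrt{|a-b|^2+2(1+|c|^2)d^2-\big|(a-b)^2+4cd^2\big|},$$ $$a_d=\frac{1}{2\sqrt2}\sqrt{|a-b|^2+2(1+|c|^2)d^2+\big|(a-b)^2+4cd^2\big|}.$$ (i) If $|c|\ne 1$, then $a,b\in\mathrm{int}\big(W(S_d)\big)=E_d$. In this case, $E_d$ is a non-degenerate open elliptical disk with foci $\lambda_1(d)$, $\lambda_2(d)$, semi-minor axis $b_d$ and semi-major axis $a_d$. (ii) If $a\ne b$ and $c=\frac{(a-b)^2}{|a-b|^2}$, then $E_d$ is the open line segment with endpoints $$\frac{a+b+(a-b)\sqrt{1+4kd^2}}{2}\quad\text{and}\quad \frac{a+b-(a-b)\sqrt{1+4kd^2}}{2},\qquad\text{where } k=\frac{1}{|a-b|^2}.$$ (iii) If $a=b$ and $|c|=1$, then $E_d$ is the open line segment with endpoints $a+d\sqrt c$ and $a-d\sqrt c$. (iv) If $a\ne b$, $|c|=1$ and $c\ne\frac{(a-b)^2}{|a-b|^2}$,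 then $a,b\in\partial\big(W(S_d)\big)$ and $$E_d=\mathrm{int}\big(W(S_d)\big)\cup\{a,b\},$$ which is an elliptical disk with the same foci $\lambda_1(d),\lambda_2(d)$, semi-minor axis $b_d$ and semi-major axis $a_d$ as in (i). Moreover, in this case $E_d$ is neither open nor closed in $\mathbb{C}$.
   Context: For $B\in M_2(\mathbb{C})$, the numerical range is $W(B)=\{\langle Bx,x\rangle: x\in\mathbb{C}^2,\ \|x\|=1\}$. For $E\subseteq\mathbb{C}$, the symbols $\overline{E}$, $\mathrm{int}(E)$, $\partial E$ denote the closure, interior and boundary of $E$ in $\mathbb{C}$. An open line segment excludes its endpoints. The square root of a complex number denotes either of its two square roots (the same choice being used in both expressions of a pair). An elliptical disk is non-degenerate if its minor axis has positive length; it may be a circular disk, in which case the two foci coincide. *)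

(* Defs.v *)
From HB Require Import structures.
From mathcomp Require Import all_boot all_order all_algebra.
From mathcomp Require Import complex.
From mathcomp Require Import all_classical all_reals all_analysis.
Import Order.TTheory GRing.Theory Num.Theory.
Import numFieldNormedType.Exports.
Set Implicit Arguments.
Unset Strict Implicit.
Unset Printing Implicit Defensive.

Local Open Scope classical_set_scope.
Local Open Scope ring_scope.

(* The topology of [C] given by the modulus; the library declares it on [R[i]^o]
   only. *)
HB.instance Definition _ (R : realType) := NormedModule.copy R[i] R[i]^o.

(* The modulus as an element of [R]; the norm [`|z|] of [R[i]] is [R[i]]-valued
   and satisfies [`|z| = (cabs z)%:C]. *)
Notation cabs := ComplexField.Normc.normc.

Definition inner (R : realType) (n : nat) (x y : 'cV[R[i]]_n) : R[i] :=
  \sum_i x i 0 * Num.conj (y i 0).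

(* The norm of [C^n]; the library norm on matrices is the sup norm. *)
Definition norm2 (R : realType) (n : nat) (x : 'cV[R[i]]_n) : R :=
  Num.sqrt (\sum_i cabs (x i 0) ^+ 2).

Definition numerical_range (R : realType) (n : nat) (B : 'M[R[i]]_n) :
    set R[i] :=
  [set inner (B *m x) x | x in [set x : 'cV[R[i]]_n | norm2 x = 1]].

Definition matS (R : realType) (a b c : R[i]) (t : R) : 'M[R[i]]_2 :=
  \matrix_(i < 2, j < 2)
    if i == 0 then (if j == 0 then a else (t%:C)%C)
    else (if j == 0 then c * (t%:C)%C else b).

Definition rangeE (R : realType) (a b c : R[i]) (d : R) : set R[i] :=
  \bigcup_(t in `]0, d[) numerical_range (matS a b c t).

Definition boundary (T : topologicalType) (A : set T) : set T :=
  closure A `\` interior A.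

Definition open_segment (R : realType) (p q : R[i]) : set R[i] :=
  [set p + (t%:C)%C * (q - p) | t in (`]0, 1[ : set R)].

(* The points inside, resp. inside or on, the ellipse with foci [f1], [f2] and
   major axis of length [2 * major].  The minor axis enters through [ellipse_data]. *)
Definition open_ellipse (R : realType) (f1 f2 : R[i]) (major : R) : set R[i] :=
  [set z | cabs (z - f1) + cabs (z - f2) < 2 * major].

Definition closed_ellipse (R : realType) (f1 f2 : R[i]) (major : R) :
    set R[i] :=
  [set z | cabs (z - f1) + cabs (z - f2) <= 2 * major].

(* Half the distance between the foci is [sqrt (major ^ 2 - minor ^ 2)]. *)
Definition ellipse_data (R : realType) (f1 f2 : R[i]) (minor major : R) : Prop :=
  [/\ 0 <= minor, 0 <= major
    & major ^+ 2 = minor ^+ 2 + (cabs (f1 - f2) / 2) ^+ 2].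

(* A disk may contain all, some or none of its bounding ellipse: when
   [0 < minor], this says that [D] lies between the open and the closed disk. *)
Definition elliptical_disk (R : realType) (D : set R[i]) (f1 f2 : R[i])
    (minor major : R) : Prop :=
  [/\ ellipse_data f1 f2 minor major,
      open_ellipse f1 f2 major `<=` D
    & closure D = closed_ellipse f1 f2 major].

Definition nondegenerate_open_elliptical_disk (R : realType) (D : set R[i])
    (f1 f2 : R[i]) (minor major : R) : Prop :=
  [/\ ellipse_data f1 f2 minor major, 0 < minor
    & D = open_ellipse f1 f2 major].

Definition discr (R : realType) (a b c : R[i]) (d : R) : R[i] :=
  (a - b) ^+ 2 + 4 * c * (d%:C)%C ^+ 2.

Definition semi_minor (R : realType) (a b c : R[i]) (d : R) : R :=
  1 / (2 * Num.sqrt 2) *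
  Num.sqrt (cabs (a - b) ^+ 2 + 2 * (1 + cabs c ^+ 2) * d ^+ 2
            - cabs (discr a b c d)).

Definition semi_major (R : realType) (a b c : R[i]) (d : R) : R :=
  1 / (2 * Num.sqrt 2) *
  Num.sqrt (cabs (a - b) ^+ 2 + 2 * (1 + cabs c ^+ 2) * d ^+ 2
            + cabs (discr a b c d)).

(* Main.v *)
Require Import Defs.
From mathcomp Require Import all_boot all_order all_algebra.
From mathcomp Require Import complex.
From mathcomp Require Import all_classical all_reals all_analysis.
From mathcomp Require Import ring lra.
Import Order.TTheory GRing.Theory Num.Theory.
Import numFieldNormedType.Exports.
Local Open Scope classical_set_scope.
Local Open Scope ring_scope.

(** Let [X = (x0, x1)] be a unit vector.  With [u = |x0|^2 - |x1|^2] and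
  [v = 2 x1 x0^*], which run over the unit sphere of [R x C = R^3],
  [<S_t X, X> = (a + b) / 2 + (u (a - b) + t (v + c v^* )) / 2].
  So [W(S_t)] is the image of the unit sphere under a real affine map to the
  plane, and also that of the closed ball, because the linear part has a kernel
  along which a point of the ball can be pushed to the sphere
  ([numerical_range_ball]).  The parameter [t] only rescales [v]: in the
  coordinates of [S_d], the sets [W(S_t)] with [t < d] come from ellipsoids with
  poles [(1, 0)], [(-1, 0)] and equatorial radius [t / d].  These fill the open
  ball and the two poles, which are sent to [a] and [b].  Hence [E_d] is the
  image of the open ball together with [a] and [b] ([rangeE_ball]).

  Now let [g_i] be the images of the basis vectors under a linear map from [R^n]
  to the plane, [T = sum_i |g_i|^2] and [P = sum_i g_i^2].  The image of the
  closed ball is the set of [w] with [|w^2 - P| + |w|^2 <= T]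
  ([closed_ball_image_criterion]), and when [|P| < T] the image of the open ball
  is given by the strict inequality ([open_ball_imageP], [image_form_lt1]).
  These are elliptical disks: if [f^2 = P], the parallelogram identity
  [(|w - f| + |w + f|)^2 = 2 |w|^2 + 2 |f|^2 + 2 |w^2 - f^2|] turns the
  criterion into a bound on the sum of the distances to [f] and [-f].  Here [P]
  is a quarter of the discriminant, whence the foci and the semi-axes
  ([elliptical_range]).

  Everything else is read off from [T] and [P].  For [w = a - (a + b) / 2] and
  [w = b - (a + b) / 2], the number [T - |w|^2 - |w^2 - P|] is
  [(1 - |c|)^2 d^2 / 2]: the points [a] and [b] are inside the ellipse when
  [|c| <> 1] and on it when [|c| = 1].  The ellipse is non-degenerate in the
  cases (i) and (iv); in the cases (ii) and (iii) [|P| = T], the [g_i] are real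
  multiples of [f], and the image of the open ball is the open segment from [f]
  to [-f], translated to the centre [(a + b) / 2]; it contains [a] and [b]
  ([rangeE_degenerate]).  In case (iv),
  [E_d] is not open because [a] is on the ellipse, and not closed because its
  closure contains a point of the ellipse other than [a] and [b]. *)

(** * The Euclidean plane of complex numbers *)

Section ComplexPlane.
Context {R : realType}.
Implicit Types (f w y z : R[i]).

Lemma complexP w z :
  complex.Re w = complex.Re z -> complex.Im w = complex.Im z -> w = z.
Proof. by case: w z => [p q] [r s] /= -> ->. Qed.

Lemma invc2 : (2 : R[i])^-1 = ((2 : R)^-1)%:C%C.
Proof. by rewrite fmorphV /= rmorph_nat. Qed.

(** The Euclidean inner product of the plane [C = R^2]. *)
Definition dotc y z : R :=
  complex.Re y * complex.Re z + complex.Im y * complex.Im z.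

Lemma cabs_ge0 z : 0 <= cabs z.
Proof. by case: z => p q; exact: sqrtr_ge0. Qed.

Lemma cabs_real_ge0 (r : R) : 0 <= r -> cabs r%:C%C = r.
Proof. by move=> r0; rewrite /= expr0n addr0 sqrtr_sqr ger0_norm. Qed.

Lemma sqr_cabs z : cabs z ^+ 2 = dotc z z.
Proof.
by case: z => p q; rewrite /= sqr_sqrtr ?addr_ge0 ?sqr_ge0 // /dotc /= !expr2.
Qed.

Lemma dotcDr y w z : dotc y (w + z) = dotc y w + dotc y z.
Proof. by case: y w z => [? ?] [? ?] [? ?]; rewrite /dotc /=; ring. Qed.

Lemma dotcZr y z (r : R) : dotc y (r%:C%C * z) = r * dotc y z.
Proof. by case: y z => [? ?] [? ?]; rewrite /dotc /=; ring. Qed.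

(** Multiplication by ['i] is a quarter turn, so the hypothesis says that [w] is on
  the real line through [f]. *)
Lemma real_multiple f w : f <> 0 -> dotc (f * 'i%C) w = 0 ->
  w = ((dotc f f)^-1 * dotc f w)%:C%C * f.
Proof.
move=> f0 fw; have : (dotc f f)^-1 * dotc f f = 1.
  rewrite mulVf // -sqr_cabs sqrf_eq0.
  by apply/eqP => /ComplexField.Normc.eq0_normc.
move: (dotc f f)^-1 fw => k; case: f w {f0} => [p q] [r s].
rewrite /dotc /= => fw kf; apply: complexP => /=.
  have := congr1 ( *%R (k * q)) fw; have := congr1 ( *%R r) kf; lra.
have := congr1 ( *%R (k * p)) fw; have := congr1 ( *%R s) kf; lra.
Qed.

(** Cauchy-Schwarz in the plane. *)
Lemma dotc_le w z : dotc w z <= cabs w * cabs z.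
Proof.
apply: le_trans (ler_norm _) _.
rewrite -(ler_pXn2r (n := 2)) ?nnegrE ?mulr_ge0 ?cabs_ge0 //.
rewrite real_normK ?num_real // exprMn !sqr_cabs -subr_ge0.
have -> : dotc w w * dotc z z - dotc w z ^+ 2 =
  (complex.Re w * complex.Im z - complex.Im w * complex.Re z) ^+ 2.
  by rewrite /dotc; ring.
exact: sqr_ge0.
Qed.

(** The balls that define the topology have radii in [R[i]]; such a radius is
  positive only if it is real, so real radii suffice. *)
Lemma nbhs_cabsP z (A : set R[i]) :
  nbhs z A <-> exists2 e : R, 0 < e & forall y, cabs (z - y) < e -> A y.
Proof.
split.
  move=> /nbhs_ballP [e /= e0 H].
  case: e e0 H => e1 e2; rewrite ltcE /= => /andP[/eqP e20 e10] H.
  exists e1 => // y hy; apply: H; rewrite -ball_normE /=.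
  by rewrite e20; change ((cabs (z - y))%:C%C < e1%:C%C); rewrite ltcR.
move=> [e e0 H]; apply/nbhs_ballP; exists (e%:C%C) => /=; first by rewrite ltcR.
move=> y; rewrite -ball_normE /= => hy; apply: H.
by rewrite -ltcR.
Qed.

End ComplexPlane.

Section Lines.
Context {R : realType}.

(** Moving a point a little way along a line, in either direction, stays in a given
  neighbourhood.  Moving towards the centre of an ellipse shows that boundary
  points are adherent to the inside, moving away from it that they are not
  interior. *)
Lemma nbhs_line (z w : R[i]) (A : set R[i]) : nbhs z A ->
  exists2 e : R, 0 < e < 1 & A (z + e%:C%C * w) /\ A (z - e%:C%C * w).
Proof.
move=> /nbhs_cabsP[e e0 hA].
pose r := Num.min (1 / 2) (e / 2 / (cabs w + 1)).
have cw : 0 < cabs w + 1 by have := cabs_ge0 w; lra.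
have r0 : 0 < r by rewrite lt_min !divr_gt0.
have re : r * cabs w < e.
  apply: le_lt_trans (_ : e / 2 < e); last by lra.
  have : r <= e / 2 / (cabs w + 1) by rewrite ge_min lexx orbT.
  rewrite ler_pdivlMr // => h; apply: le_trans h.
  by rewrite ler_pM2l //; lra.
have crw : cabs (r%:C%C * w) = r * cabs w.
  by rewrite ComplexField.Normc.normcM cabs_real_ge0 // ltW.
exists r; first by rewrite r0 gt_min; apply/orP; left; lra.
split; apply: hA.
  have -> : z - (z + r%:C%C * w) = - (r%:C%C * w) by ring.
  by rewrite normcN crw.
have -> : z - (z - r%:C%C * w) = r%:C%C * w by ring.
by rewrite crw.
Qed.

End Lines.

(** * Images of balls under linear maps to the plane *)

Section PlanarMap.
Context {R : realType} {n : nat}.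
Variable g : 'I_n -> R[i].
Implicit Types (x : 'I_n -> R) (w y z f : R[i]).

Definition sqn x : R := \sum_i x i ^+ 2.

Definition planar_map x : R[i] := \sum_i (x i)%:C%C * g i.

(** The trace of the positive symmetric matrix [Q = sum_i g_i g_i^T], where [g_i] is
  seen as a vector of [R^2].  The image of the unit ball is the set of [w] with
  [w^T Q^-1 w <= 1] when [Q] is invertible. *)
Definition image_trace : R := \sum_i cabs (g i) ^+ 2.

(** The traceless part of [2 Q], as a complex number: the eigenvalues of [Q] are
  [(T + |P|) / 2] and [(T - |P|) / 2], and the foci of the image of the unit ball
  are the square roots of [P]. *)
Definition image_sqfocus : R[i] := \sum_i g i ^+ 2.

Local Notation T := image_trace.
Local Notation P := image_sqfocus.

Lemma sqn_ge0 x : 0 <= sqn x.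
Proof. by apply: sumr_ge0 => i _; exact: sqr_ge0. Qed.

Lemma sqnZ (r : R) x : sqn (fun i => r * x i) = r ^+ 2 * sqn x.
Proof. by rewrite /sqn mulr_sumr; apply: eq_bigr => i _; rewrite exprMn. Qed.

Lemma planar_mapZ (r : R) x :
  planar_map (fun i => r * x i) = r%:C%C * planar_map x.
Proof.
rewrite /planar_map mulr_sumr; apply: eq_bigr => i _.
by rewrite rmorphM /= mulrA.
Qed.

Lemma dotc_planar_map y x : dotc y (planar_map x) = \sum_i x i * dotc y (g i).
Proof.
rewrite /planar_map (big_morph (dotc y) (dotcDr y) (_ : dotc y 0 = 0)).
  by apply: eq_bigr => i _; rewrite dotcZr.
by rewrite /dotc !mulr0 addr0.
Qed.

(** The left-hand side is [Q y]. *)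
Lemma planar_map_dotc y :
  planar_map (fun i => dotc y (g i)) = (T%:C%C * y + P * conjc y) / 2.
Proof.
rewrite /planar_map /image_trace /image_sqfocus (rmorph_sum (real_complex R)) /=.
rewrite !mulr_suml -big_split mulr_suml /=; apply: eq_bigr => i _.
rewrite sqr_cabs invc2; case: (g i) y => [p q] [r s].
by apply: complexP; rewrite /dotc /=; field.
Qed.

Lemma sqn_dotc y : sqn (fun i => dotc y (g i)) =
  dotc y (planar_map (fun i => dotc y (g i))).
Proof. by rewrite dotc_planar_map; apply: eq_bigr => i _; rewrite expr2. Qed.

(** A preimage of the form [dotc y (g i)] is orthogonal to the kernel of the map, so
  no preimage of the same point is shorter. *)
Lemma least_squares y x :
  planar_map x = planar_map (fun i => dotc y (g i)) ->
  sqn (fun i => dotc y (g i)) <= sqn x.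
Proof.
move=> Lx; have := sqn_ge0 (fun i => x i - dotc y (g i)).
have -> : sqn (fun i => x i - dotc y (g i)) = sqn x
   - 2 * (\sum_i x i * dotc y (g i)) + sqn (fun i => dotc y (g i)).
  rewrite /sqn mulr_sumr -sumrB -big_split /=.
  by apply: eq_bigr => i _; ring.
rewrite -dotc_planar_map Lx -sqn_dotc; lra.
Qed.

Lemma cabs_sqfocus_le : cabs P <= T.
Proof.
rewrite /image_trace /image_sqfocus.
elim/big_ind2: _ => [|u r v s hu hv|i _].
- by rewrite ComplexField.Normc.normc0.
- by apply: le_trans (le_normcD _ _) _; exact: lerD.
by rewrite !expr2 ComplexField.Normc.normcM.
Qed.

(** The quadratic form [w^T Q^-1 w]; the denominator is [4 det Q]. *)
Definition image_form w : R :=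
  2 * (T * cabs w ^+ 2 - dotc P (w ^+ 2)) / (T ^+ 2 - cabs P ^+ 2).

Lemma image_formZ (r : R) w : image_form (r%:C%C * w) = r ^+ 2 * image_form w.
Proof.
rewrite /image_form exprMn -rmorphXn /= dotcZr !sqr_cabs.
by case: w => p q; rewrite /dotc /=; ring.
Qed.

Section NonDegenerate.
Hypothesis ndeg : cabs P < T.

Let T_gt0 : 0 < T. Proof. exact: le_lt_trans (cabs_ge0 _) ndeg. Qed.

Let det_gt0 : 0 < T ^+ 2 - cabs P ^+ 2.
Proof. by rewrite subr_gt0 ltr_pXn2r ?nnegrE ?cabs_ge0 // ltW. Qed.

(** Since [Q y = (T y + P y^* ) / 2], the vector [y = Q^-1 w] is
  [2 (T w - P w^* ) / (T^2 - |P|^2)]. *)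
Lemma least_squares_preimage w : exists2 y,
  planar_map (fun i => dotc y (g i)) = w & dotc y w = image_form w.
Proof.
exists ((2 / (T ^+ 2 - cabs P ^+ 2))%:C%C * (T%:C%C * w - P * conjc w)).
  have := det_gt0; rewrite planar_map_dotc invc2 sqr_cabs.
  case: P w => [p q] [r s]; rewrite /dotc /= => h.
  by apply: complexP => /=; field; rewrite -!expr2 gt_eqF.
have := det_gt0; rewrite /image_form !sqr_cabs.
case: P w => [p q] [r s]; rewrite /dotc /= => h.
by field; rewrite gt_eqF.
Qed.

Lemma image_form_le x : image_form (planar_map x) <= sqn x.
Proof.
have [y Ly qy] := least_squares_preimage (planar_map x).
by rewrite -qy -{1}Ly -sqn_dotc least_squares.
Qed.

Lemma image_form_attained w :
  exists2 x, planar_map x = w & sqn x = image_form w.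
Proof.
have [y Ly qy] := least_squares_preimage w.
by exists (fun i => dotc y (g i)); rewrite // sqn_dotc Ly.
Qed.

Lemma open_ball_imageP w :
  (exists2 x, sqn x < 1 & planar_map x = w) <-> image_form w < 1.
Proof.
split=> [[x x1 <-]|w1]; first exact: le_lt_trans (image_form_le x) x1.
by have [x xw xq] := image_form_attained w; exists x; rewrite ?xq.
Qed.

Lemma closed_ball_imageP w :
  (exists2 x, sqn x <= 1 & planar_map x = w) <-> image_form w <= 1.
Proof.
split=> [[x x1 <-]|w1]; first exact: le_trans (image_form_le x) x1.
by have [x xw xq] := image_form_attained w; exists x; rewrite ?xq.
Qed.

Lemma image_form_gt0 w : w <> 0 -> 0 < image_form w.
Proof.
move=> w0; have [x xw <-] := image_form_attained w.
rewrite lt_neqAle sqn_ge0 andbT eq_sym; apply/negP => /eqP x0.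
apply: w0; rewrite -xw /planar_map big1 // => i _.
have /psumr_eq0P := x0 => /(_ (fun i _ => sqr_ge0 (x i))) /(_ i isT) /eqP.
by rewrite sqrf_eq0 => /eqP ->; rewrite mul0r.
Qed.

Let image_form_sub w :
  (T - cabs w ^+ 2) ^+ 2 - cabs (w ^+ 2 - P) ^+ 2 =
  (T ^+ 2 - cabs P ^+ 2) * (1 - image_form w).
Proof.
have := det_gt0; rewrite /image_form !sqr_cabs.
case: P w => [p q] [r s]; rewrite /dotc /= => h.
by field; rewrite gt_eqF.
Qed.

(* [dotc P (w ^+ 2) <= |P| |w|^2] gives [2 |w|^2 <= T + |P| < 2 T]. *)
Let image_form_trace w : image_form w <= 1 -> cabs w ^+ 2 < T.
Proof.
rewrite /image_form ler_pdivrMr // mul1r => h.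
have := dotc_le P (w ^+ 2).
rewrite expr2 ComplexField.Normc.normcM -!expr2 => h'.
have := cabs_ge0 P; have := sqr_ge0 (cabs w); move: ndeg h h'.
set N := cabs w ^+ 2; set D := dotc _ _; set p := cabs P; move=> *.
nra.
Qed.

(** Isolating the modulus [cabs (w ^+ 2 - P)] and squaring leaves a multiple of
  [1 - image_form w]; the squaring can be undone as both conditions force
  [cabs w ^+ 2 < T]. *)
Lemma image_form_lt1 w :
  (image_form w < 1) = (cabs (w ^+ 2 - P) + cabs w ^+ 2 < T).
Proof.
rewrite -ltrBrDr; apply/idP/idP => h.
  have hT := image_form_trace _ (ltW h).
  rewrite -(ltr_pXn2r (n := 2)) ?nnegrE ?cabs_ge0 ?subr_ge0 ?(ltW hT) //.
  rewrite -subr_gt0 image_form_sub.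
  by rewrite pmulr_rgt0 // subr_gt0.
have hT : cabs w ^+ 2 < T by rewrite -subr_gt0; apply: le_lt_trans h; exact: cabs_ge0.
rewrite -subr_gt0 -(pmulr_rgt0 _ det_gt0) -image_form_sub //.
by rewrite subr_gt0 ltr_pXn2r ?nnegrE ?cabs_ge0 ?subr_ge0 // ltW.
Qed.

Lemma image_form_le1 w :
  (image_form w <= 1) = (cabs (w ^+ 2 - P) + cabs w ^+ 2 <= T).
Proof.
rewrite -lerBrDr; apply/idP/idP => h.
  have hT := image_form_trace _ h.
  rewrite -(ler_pXn2r (n := 2)) ?nnegrE ?cabs_ge0 ?subr_ge0 ?(ltW hT) //.
  rewrite -subr_ge0 image_form_sub //.
  by rewrite pmulr_rge0 // subr_ge0.
have hT : cabs w ^+ 2 <= T by rewrite -subr_ge0; apply: le_trans h; exact: cabs_ge0.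
rewrite -subr_ge0 -(pmulr_rge0 _ det_gt0) -image_form_sub //.
by rewrite subr_ge0 ler_pXn2r ?nnegrE ?cabs_ge0 ?subr_ge0.
Qed.

End NonDegenerate.

Section Degenerate.
Variable f : R[i].
Hypotheses (f_neq0 : f <> 0) (Pf : P = f ^+ 2) (Tf : T = cabs P).

Let dotcff_gt0 : 0 < dotc f f.
Proof.
rewrite -sqr_cabs lt_neqAle sqr_ge0 andbT eq_sym sqrf_eq0.
by apply/eqP => /ComplexField.Normc.eq0_normc.
Qed.

Let trace_dotc : T = dotc f f.
Proof. by rewrite Tf Pf expr2 ComplexField.Normc.normcM -expr2 sqr_cabs. Qed.

Let collinear i : dotc (f * 'i%C) (g i) = 0.
Proof.
have : sqn (fun i => dotc (f * 'i%C) (g i)) = 0.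
  rewrite sqn_dotc planar_map_dotc trace_dotc Pf invc2.
  by case: f => p q; rewrite /dotc /=; ring.
move=> /psumr_eq0P => /(_ (fun i _ => sqr_ge0 _)) /(_ i isT) /eqP.
by rewrite sqrf_eq0 => /eqP.
Qed.

(** The component of [g i] orthogonal to [f] vanishes, because the sum of the squares
  of these components is [(T - |P|) / 2]. *)
Lemma degenerate_coordinates : exists2 r : 'I_n -> R,
  sqn r = 1 & forall i, g i = (r i)%:C%C * f.
Proof.
exists (fun i => (dotc f f)^-1 * dotc f (g i)).
  rewrite sqnZ sqn_dotc planar_map_dotc trace_dotc Pf invc2.
  have := dotcff_gt0; case: f => p q; rewrite /dotc /= => h.
  by field; rewrite gt_eqF.
by move=> i; rewrite -real_multiple.
Qed.

(** Cauchy-Schwarz: with coordinates [r] of norm 1, [t = sum_i x_i r_i] satisfies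
  [t^2 <= sqn x], with equality for the multiples of [r]. *)
Lemma degenerate_ball_image x : exists2 t : R,
  t ^+ 2 <= sqn x & planar_map x = t%:C%C * f.
Proof.
have [r r1 gr] := degenerate_coordinates.
have sq t : sqn (fun i => x i - t * r i) =
    sqn x - 2 * t * (\sum_i x i * r i) + t ^+ 2 * sqn r.
  rewrite /sqn !mulr_sumr -sumrB -big_split /=.
  by apply: eq_bigr => i _; ring.
exists (\sum_i x i * r i).
  have := sqn_ge0 (fun i => x i - (\sum_i x i * r i) * r i).
  rewrite sq r1; lra.
rewrite rmorph_sum mulr_suml; apply: eq_bigr => i _.
by rewrite rmorphM gr mulrA.
Qed.

Lemma degenerate_ball_preimage t : exists2 x,
  sqn x = t ^+ 2 & planar_map x = t%:C%C * f.
Proof.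
have [r r1 gr] := degenerate_coordinates.
have Lr : planar_map r = f.
  rewrite /planar_map (eq_bigr (fun i => (r i ^+ 2)%:C%C * f)).
    by rewrite -mulr_suml -(rmorph_sum (real_complex R)) /= -/(sqn r) r1 mul1r.
  by move=> i _; rewrite gr mulrA -rmorphM expr2.
exists (fun i => t * r i); first by rewrite sqnZ r1 mulr1.
by rewrite planar_mapZ Lr.
Qed.

(** The squared criterion says that [dotc (f * 'i) w ^+ 2 <= 0]. *)
Lemma degenerate_criterion w : cabs (w ^+ 2 - P) + cabs w ^+ 2 <= T ->
  exists2 t : R, t ^+ 2 <= 1 & w = t%:C%C * f.
Proof.
rewrite -lerBrDr => h.
have wT : cabs w ^+ 2 <= T.
  by rewrite -subr_ge0; apply: le_trans h; exact: cabs_ge0.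
move: h; rewrite -(ler_pXn2r (n := 2)) ?nnegrE ?cabs_ge0 ?subr_ge0 //.
move: wT; rewrite !sqr_cabs trace_dotc Pf => wT h.
have cross : dotc (f * 'i%C) w = 0.
  move: h {wT}; case: f w => [p q] [r s]; rewrite /dotc /= => h.
  apply/eqP; rewrite -sqrf_eq0 eq_le sqr_ge0 andbT; nra.
rewrite [w](real_multiple f) // in wT *; set t := _^-1 * _ in wT *.
exists t => //; move: wT.
have -> : dotc (t%:C%C * f) (t%:C%C * f) = t ^+ 2 * dotc f f.
  by case: f => p q; rewrite /dotc /=; ring.
by rewrite ger_pMl.
Qed.

End Degenerate.

(** Unlike [closed_ball_imageP], the criterion has no denominator and also covers the
  case where the image is a segment. *)
Lemma closed_ball_image_criterion w : 0 < T ->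
  (exists2 x, sqn x <= 1 & planar_map x = w) <->
  cabs (w ^+ 2 - P) + cabs w ^+ 2 <= T.
Proof.
move=> T0; have := cabs_sqfocus_le; rewrite le_eqVlt => /orP[/eqP PT|ndeg]; last first.
  by rewrite -image_form_le1 // closed_ball_imageP.
have Pf := esym (sqr_sqrtc P); set f := sqrtc P in Pf.
have f0 : f <> 0.
  move=> f0; move: T0; rewrite -PT Pf f0 expr2 mulr0.
  by rewrite ComplexField.Normc.normc0 ltxx.
have Tff : T = cabs f ^+ 2 by rewrite -PT Pf !expr2 ComplexField.Normc.normcM.
split.
  move=> [x x1 <-].
  have [t tx ->] := degenerate_ball_image f f0 Pf (esym PT) x.
  have t1 := le_trans tx x1.
  have -> : (t%:C%C * f) ^+ 2 - P = (t ^+ 2 - 1)%:C%C * f ^+ 2.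
    by rewrite Pf rmorphB rmorph1 rmorphXn /=; ring.
  rewrite [f ^+ 2]expr2 !ComplexField.Normc.normcM exprMn -expr2 -Tff.
  have -> : cabs t%:C%C ^+ 2 = t ^+ 2 by rewrite sqr_cabs /dotc /=; ring.
  have -> : cabs (t ^+ 2 - 1)%:C%C = 1 - t ^+ 2.
    rewrite /= expr0n addr0 sqrtr_sqr ler0_norm ?subr_le0 //; ring.
  by rewrite le_eqVlt; apply/orP; left; apply/eqP; ring.
move=> /(degenerate_criterion f f0 Pf (esym PT)) [t t1 ->].
have [x xt <-] := degenerate_ball_preimage f f0 Pf (esym PT) t.
by exists x; rewrite ?xt.
Qed.

End PlanarMap.

Section Sphere.
Context {R : realType} {n : nat}.
Variable g : 'I_n -> R[i].

(** The real and imaginary parts of the [g i] form an [n x 2] matrix, whose left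
  kernel is not zero when [2 < n]. *)
Lemma planar_map_kernel : (2 < n)%N ->
  exists2 k : 'I_n -> R, 0 < sqn k & planar_map g k = 0.
Proof.
move=> n2.
pose M := \matrix_(i < n, j < 2)
  if j == 0 then complex.Re (g i) else complex.Im (g i).
have /rowV0Pn[v /sub_kermxP vM v0] : kermx M != 0.
  rewrite -mxrank_eq0 mxrank_ker -lt0n subn_gt0.
  exact: leq_ltn_trans (rank_leq_col M) n2.
exists (fun i => v 0 i).
  rewrite lt_neqAle sqn_ge0 andbT eq_sym; apply/negP => /eqP sq0.
  move/eqP: v0; apply; apply/rowP => i; rewrite mxE.
  have /psumr_eq0P := sq0 => /(_ (fun i _ => sqr_ge0 _)) /(_ i isT) /eqP.
  by rewrite sqrf_eq0 => /eqP.
have part j : dotc (if j == 0 then 1 else 'i%C)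
    (planar_map g (fun i => v 0 i)) = (v *m M) 0 j.
  rewrite dotc_planar_map mxE; apply: eq_bigr => i _; rewrite mxE.
  by case: (j == 0); case: (g i) => p q; rewrite /dotc /=; ring.
have := part 1; have := part 0; rewrite vM !mxE /=.
case: (planar_map _ _) => p q; rewrite /dotc /= => h h'.
by apply: complexP => /=; lra.
Qed.

(** A line through a point of the ball, in the direction of the kernel, meets the
  sphere, and all its points have the same image. *)
Lemma sphere_image x : (2 < n)%N -> sqn x <= 1 ->
  exists2 y : 'I_n -> R, sqn y = 1 & planar_map g y = planar_map g x.
Proof.
move=> n2 x1; have [k k0 Lk] := planar_map_kernel n2.
pose B := \sum_i x i * k i.
(* [t] below is a root of [sqn k * t^2 + 2 B t + sqn x - 1]. *)
pose D := B ^+ 2 + sqn k * (1 - sqn x).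
have D0 : 0 <= D by rewrite addr_ge0 ?sqr_ge0 ?mulr_ge0 ?subr_ge0 ?(ltW k0).
pose t := (Num.sqrt D - B) / sqn k.
have tk : t * sqn k + B = Num.sqrt D by rewrite divfK ?gt_eqF // subrK.
exists (fun i => x i + t * k i).
  have -> : sqn (fun i => x i + t * k i) = sqn x + 2 * t * B + t ^+ 2 * sqn k.
    rewrite /B /sqn; move: t {tk} => t; rewrite !mulr_sumr -!big_split /=.
    by apply: eq_bigr => i _; ring.
  have := congr1 (fun u => u ^+ 2) tk; rewrite sqr_sqrtr // /D => tk2.
  apply/eqP; rewrite -subr_eq0 -(mulrI_eq0 _ (lregP (lt0r_neq0 k0))).
  by apply/eqP; move: tk2; clearbody t B; set K := sqn k; lra.
rewrite -[RHS]addr0 -[0](mulr0 t%:C%C) -Lk -planar_mapZ /planar_map -big_split.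
by apply: eq_bigr => i _ /=; rewrite rmorphD mulrDl.
Qed.

End Sphere.

(** * Ellipses given by their foci *)

Section Ellipse.
Context {R : realType}.
Implicit Types (f m w z : R[i]).

(* The parallelogram identity, with the product of the two distances equal to
  [cabs (w ^+ 2 - f ^+ 2)]. *)
Let focal_sum w f (M T : R) : 2 * M ^+ 2 = T + cabs (f ^+ 2) ->
  (2 * M) ^+ 2 - (cabs (w - f) + cabs (w + f)) ^+ 2 =
  2 * (T - (cabs (w ^+ 2 - f ^+ 2) + cabs w ^+ 2)).
Proof.
have -> : w ^+ 2 - f ^+ 2 = (w - f) * (w + f) by ring.
rewrite [f ^+ 2]expr2 !ComplexField.Normc.normcM -expr2 => h.
have : cabs (w - f) ^+ 2 + cabs (w + f) ^+ 2 = 2 * (cabs w ^+ 2 + cabs f ^+ 2).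
  by rewrite !sqr_cabs; case: w f {h} => [p q] [r s]; rewrite /dotc /=; ring.
lra.
Qed.

Lemma open_ellipseP m f (M T : R) z : 0 <= M ->
  2 * M ^+ 2 = T + cabs (f ^+ 2) ->
  open_ellipse (m + f) (m - f) M z <->
  cabs ((z - m) ^+ 2 - f ^+ 2) + cabs (z - m) ^+ 2 < T.
Proof.
move=> M0 h; rewrite /open_ellipse /=.
have -> : z - (m + f) = z - m - f by ring.
have -> : z - (m - f) = z - m + f by ring.
have e := focal_sum (z - m) f M T h.
rewrite -(ltr_pXn2r (n := 2)) ?nnegrE ?addr_ge0 ?mulr_ge0 ?cabs_ge0 //.
by rewrite -subr_gt0 e pmulr_rgt0 // subr_gt0.
Qed.

Lemma closed_ellipseP m f (M T : R) z : 0 <= M ->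
  2 * M ^+ 2 = T + cabs (f ^+ 2) ->
  closed_ellipse (m + f) (m - f) M z <->
  cabs ((z - m) ^+ 2 - f ^+ 2) + cabs (z - m) ^+ 2 <= T.
Proof.
move=> M0 h; rewrite /closed_ellipse /=.
have -> : z - (m + f) = z - m - f by ring.
have -> : z - (m - f) = z - m + f by ring.
have e := focal_sum (z - m) f M T h.
rewrite -(ler_pXn2r (n := 2)) ?nnegrE ?addr_ge0 ?mulr_ge0 ?cabs_ge0 //.
by rewrite -subr_ge0 e pmulr_rge0 // subr_ge0.
Qed.

Let focal_sum_lip (f1 f2 y z : R[i]) : cabs (y - f1) + cabs (y - f2) <=
  cabs (z - f1) + cabs (z - f2) + 2 * cabs (z - y).
Proof.
have tri f : cabs (y - f) <= cabs (z - f) + cabs (z - y).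
  have -> : y - f = (z - f) + (y - z) by ring.
  apply: le_trans (le_normcD _ _) _.
  by rewrite -[y - z]opprB normcN.
have := tri f1; have := tri f2; lra.
Qed.

Lemma open_ellipse_open f1 f2 (M : R) : open (open_ellipse f1 f2 M).
Proof.
rewrite openE => z hz; apply/nbhs_cabsP; move: hz; rewrite /open_ellipse /= => hz.
exists ((2 * M - (cabs (z - f1) + cabs (z - f2))) / 2); first by lra.
by move=> y hy; have := focal_sum_lip f1 f2 y z; lra.
Qed.

Lemma closed_ellipse_closed f1 f2 (M : R) : closed (closed_ellipse f1 f2 M).
Proof.
move=> z hz; rewrite /closed_ellipse /= leNgt; apply/negP => lt.
have /hz [y [/=]] : nbhs z [set y | 2 * M < cabs (y - f1) + cabs (y - f2)].
  apply/nbhs_cabsP.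
  exists ((cabs (z - f1) + cabs (z - f2) - 2 * M) / 2); first by lra.
  move=> y hy; have := focal_sum_lip f1 f2 z y.
  by rewrite -[y - z]opprB normcN /=; lra.
by rewrite /closed_ellipse /=; lra.
Qed.

End Ellipse.

(** * Numerical ranges as images of balls *)

Lemma sum3 (V : nmodType) (F : 'I_3 -> V) :
  \sum_i F i = F ord0 + F 1 + F ord_max.
Proof.
rewrite !big_ord_recl big_ord0 addr0 addrA.
by congr (_ + F _ + F _); exact: val_inj.
Qed.

Section NumericalRange.
Context {R : realType}.
Variables a b c : R[i].

(** Half the image of each basis vector of [R x C] under
  [(u, v) |-> u (a - b) + t (v + c v^* )]. *)
Definition bloch (t : R) (i : 'I_3) : R[i] :=
  nth 0 [:: (a - b) / 2; t%:C%C * (1 + c) / 2; t%:C%C * ('i%C * (1 - c)) / 2] i.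

Definition vec3 (u p q : R) (i : 'I_3) : R := nth 0 [:: u; p; q] i.

Lemma sqn_vec3 u p q : sqn (vec3 u p q) = u ^+ 2 + p ^+ 2 + q ^+ 2.
Proof. by rewrite /sqn sum3. Qed.

Lemma planar_map_bloch t x : planar_map (bloch t) x =
  ((x ord0)%:C%C * (a - b) + t%:C%C *
    (((x 1) +i* (x ord_max))%C + c * ((x 1) -i* (x ord_max))%C)) / 2.
Proof.
rewrite /planar_map sum3 /bloch /= invc2.
by case: a b c => [? ?] [? ?] [? ?]; apply: complexP => /=; field.
Qed.

Lemma sqfocus_bloch t : image_sqfocus (bloch t) = discr a b c t / 4.
Proof.
rewrite /image_sqfocus sum3 /bloch /discr /=.
have := sqr_i R; set I := 'i%C => I2.
have e (k : R[i]) : (k * (I * (1 - c)) / 2) ^+ 2 = - (k * (1 - c) / 2) ^+ 2.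
  have -> : (k * (I * (1 - c)) / 2) ^+ 2 = I ^+ 2 * (k * (1 - c) / 2) ^+ 2 by ring.
  by rewrite I2 mulN1r.
by rewrite e; field.
Qed.

Lemma trace_bloch t : image_trace (bloch t) =
  (cabs (a - b) ^+ 2 + 2 * (1 + cabs c ^+ 2) * t ^+ 2) / 4.
Proof.
rewrite /image_trace sum3 /bloch /= invc2 !sqr_cabs.
by case: a b c => [? ?] [? ?] [? ?]; rewrite /dotc /=; field.
Qed.

(** The Hopf map [(x0, x1) |-> (|x0|^2 - |x1|^2, 2 x1 x0^* )] sends the unit sphere of
  [C^2] onto that of [R x C]. *)
Lemma numerical_range_sphere t z : numerical_range (matS a b c t) z <->
  exists2 x, sqn x = 1 & planar_map (bloch t) x = z - (a + b) / 2.
Proof.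
have nE (X : 'cV[R[i]]_2) : norm2 X = 1 <-> cabs (X 0 0) ^+ 2 + cabs (X 1 0) ^+ 2 = 1.
  rewrite /norm2 big_ord_recl big_ord_recl big_ord0 addr0.
  have -> : lift ord0 (ord0 : 'I_1) = 1 :> 'I_2 by exact: val_inj.
  have N0 : 0 <= cabs (X 0 0) ^+ 2 + cabs (X 1 0) ^+ 2 by rewrite addr_ge0 ?sqr_ge0.
  split=> [h|->]; last exact: sqrtr1.
  by rewrite -[LHS]sqr_sqrtr // h expr1n.
have iE (X : 'cV[R[i]]_2) : inner (matS a b c t *m X) X =
    a * (cabs (X 0 0) ^+ 2)%:C%C + b * (cabs (X 1 0) ^+ 2)%:C%C +
    t%:C%C * (X 1 0 * conjc (X 0 0) + c * conjc (X 1 0 * conjc (X 0 0))).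
  rewrite /inner big_ord_recl big_ord_recl big_ord0 addr0.
  have -> : lift ord0 (ord0 : 'I_1) = 1 :> 'I_2 by exact: val_inj.
  rewrite /matS !mxE !(big_ord_recl, big_ord0) !addr0.
  have -> : lift ord0 (ord0 : 'I_1) = 1 :> 'I_2 by exact: val_inj.
  rewrite !mxE /= !sqr_cabs.
  case: (X 0 0) (X 1 0) a b c => [? ?] [? ?] [? ?] [? ?] [? ?].
  by apply: complexP; rewrite /dotc /=; ring.
split.
  move=> [X /= /nE nX <-]; exists (vec3
      (cabs (X 0 0) ^+ 2 - cabs (X 1 0) ^+ 2)
      (2 * dotc (X 0 0) (X 1 0)) (2 * dotc (X 0 0 * 'i%C) (X 1 0))).
    rewrite sqn_vec3; move: nX; rewrite !sqr_cabs.
    case: (X 0 0) (X 1 0) => [p q] [r s]; rewrite /dotc /= => nX.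
    by have := congr1 (fun u => u ^+ 2) nX; rewrite /= expr1n; lra.
  rewrite planar_map_bloch iE /vec3 /=.
  have -> : (a + b) / 2 = (a + b) / 2 * (cabs (X 0 0) ^+ 2 + cabs (X 1 0) ^+ 2)%:C%C.
    by rewrite nX mulr1.
  rewrite !sqr_cabs invc2.
  case: (X 0 0) (X 1 0) a b c => [? ?] [? ?] [? ?] [? ?] [? ?].
  by apply: complexP; rewrite /dotc /=; field.
move=> [x x1 Lx].
have [X [X0 X1 X10]] : exists X : 'cV[R[i]]_2,
    [/\ cabs (X 0 0) ^+ 2 = (1 + x ord0) / 2, cabs (X 1 0) ^+ 2 = (1 - x ord0) / 2
      & X 1 0 * conjc (X 0 0) = (x 1 +i* x ord_max)%C / 2].
  move: x1; rewrite /sqn sum3; move: (x ord0) (x 1) (x ord_max) => u p q upq.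
  have u2 : -1 <= u.
    have : u ^+ 2 <= 1 by have := sqr_ge0 p; have := sqr_ge0 q; lra.
    by nra.
  have colE (s1 s2 : R[i]) : exists X : 'cV[R[i]]_2, X 0 0 = s1 /\ X 1 0 = s2.
    by exists (\col_i (if i == 0 then s1 else s2)); rewrite !mxE.
  (* Over every point but the south pole, the Hopf map has a preimage with real
     positive first coordinate. *)
  have [um|um] := eqVneq u (-1).
    have [X [X0 X1]] := colE 0 1; exists X; rewrite X0 X1.
    have p2 : p ^+ 2 <= 0 by have := sqr_ge0 q; move: upq; rewrite um; lra.
    have q2 : q ^+ 2 <= 0 by have := sqr_ge0 p; move: upq; rewrite um; lra.
    have {p2} -> : p = 0 by apply/eqP; rewrite -sqrf_eq0 eq_le p2 sqr_ge0.
    have {q2} -> : q = 0 by apply/eqP; rewrite -sqrf_eq0 eq_le q2 sqr_ge0.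
    rewrite um !sqr_cabs /dotc /=; split; [by field|by field|].
    by rewrite invc2; apply: complexP => /=; ring.
  have u1 : 0 < (1 + u) / 2 by move: u2; rewrite le_eqVlt eq_sym (negPf um) /=; lra.
  set r := Num.sqrt ((1 + u) / 2).
  have r0 : r != 0 by rewrite gt_eqF // sqrtr_gt0.
  have r2 : r ^+ 2 = (1 + u) / 2 by rewrite sqr_sqrtr // ltW.
  have [X [X0 X1]] := colE r%:C%C ((p / (2 * r)) +i* (q / (2 * r)))%C.
  exists X; rewrite X0 X1.
  rewrite invc2 !sqr_cabs /dotc /=; split.
  - by rewrite -r2; ring.
  - have -> : p / (2 * r) * (p / (2 * r)) + q / (2 * r) * (q / (2 * r)) =
              (p ^+ 2 + q ^+ 2) / (4 * r ^+ 2) by field; rewrite ?r0.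
    have -> : p ^+ 2 + q ^+ 2 = (1 - u) * (1 + u) by lra.
    by rewrite r2; field; rewrite gt_eqF //; lra.
  by apply: complexP => /=; field.
exists X; first by apply/nE; rewrite X0 X1; field.
rewrite iE X0 X1 X10 -[z](subrK ((a + b) / 2)) -Lx planar_map_bloch invc2.
move: (x ord0) (x 1) (x ord_max) => u p q.
by case: a b c => [? ?] [? ?] [? ?]; apply: complexP => /=; field.
Qed.

End NumericalRange.

Section Union.
Context {R : realType}.
Variables (a b c : R[i]) (d : R).
Hypothesis d_gt0 : 0 < d.

Lemma numerical_range_ball t z : numerical_range (matS a b c t) z <->
  exists2 x, sqn x <= 1 & planar_map (bloch a b c t) x = z - (a + b) / 2.
Proof.
rewrite numerical_range_sphere; split=> [[x x1 <-]|[x x1 <-]].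
  by exists x; rewrite ?x1.
exact: sphere_image.
Qed.

Lemma planar_map_pole t e : planar_map (bloch a b c t) (vec3 e 0 0) =
  e%:C%C * (a - b) / 2.
Proof.
rewrite planar_map_bloch /vec3 /= invc2.
by case: a b c => [? ?] [? ?] [? ?]; apply: complexP => /=; ring.
Qed.

Lemma diagonal_fst : a - (a + b) / 2 = (a - b) / 2.
Proof. by field. Qed.

Lemma diagonal_snd : b - (a + b) / 2 = - ((a - b) / 2).
Proof. by field. Qed.

Lemma corner_preimage t z : [set a; b] z ->
  exists2 x, sqn x = 1 & planar_map (bloch a b c t) x = z - (a + b) / 2.
Proof.
move=> [] ->; [exists (vec3 1 0 0) | exists (vec3 (-1) 0 0)].
- by rewrite sqn_vec3; lra.
- by rewrite planar_map_pole diagonal_fst rmorph1 mul1r.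
- by rewrite sqn_vec3; lra.
by rewrite planar_map_pole diagonal_snd rmorphN rmorph1 mulN1r mulNr.
Qed.

(** For [t < d] the sphere at parameter [t] becomes, at parameter [d], an ellipsoid
  inside the unit sphere that touches it at the poles. *)
Lemma rangeE_ball z : rangeE a b c d z <->
  (exists2 x, sqn x < 1 & planar_map (bloch a b c d) x = z - (a + b) / 2) \/
  [set a; b] z.
Proof.
split.
  move=> [t]; rewrite /= in_itv /= => /andP[t0 td].
  move=> /numerical_range_sphere [x x1 Lx].
  have [u1|u1] := eqVneq (x ord0 ^+ 2) 1.
    right; move: x1 Lx; rewrite /sqn sum3 u1 planar_map_bloch => x1.
    have p0 : x 1 = 0.
      apply/eqP; rewrite -sqrf_eq0 eq_le sqr_ge0 andbT.
      by have := sqr_ge0 (x ord_max); lra.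
    have q0 : x ord_max = 0.
      apply/eqP; rewrite -sqrf_eq0 eq_le sqr_ge0 andbT.
      by have := sqr_ge0 (x 1); lra.
    rewrite p0 q0; set L := (_ + _) / 2 => Lz.
    have {Lz} -> : z = L + (a + b) / 2 by rewrite Lz subrK.
    rewrite /L.
    move/eqP: u1; rewrite sqrf_eq1 => /orP[] /eqP ->; [left|right] => /=;
    by rewrite invc2; case: a b c => [? ?] [? ?] [? ?]; apply: complexP => /=; field.
  left; exists (vec3 (x ord0) (t / d * x 1) (t / d * x ord_max)).
    have u1' : x ord0 ^+ 2 < 1.
      move: x1; rewrite lt_neqAle u1 /= /sqn sum3.
      by have := sqr_ge0 (x 1); have := sqr_ge0 (x ord_max); lra.
    have s1 : (t / d) ^+ 2 < 1.
      by rewrite expr_lt1 ?divr_ge0 ?ltW // ltr_pdivrMr ?mul1r.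
    rewrite sqn_vec3; move: x1; rewrite /sqn sum3 => x1.
    have -> : x ord0 ^+ 2 + (t / d * x 1) ^+ 2 + (t / d * x ord_max) ^+ 2 =
      x ord0 ^+ 2 + (t / d) ^+ 2 * (1 - x ord0 ^+ 2).
      have -> : 1 - x ord0 ^+ 2 = x 1 ^+ 2 + x ord_max ^+ 2 by lra.
      by ring.
    by nra.
  have d0 : d != 0 by rewrite gt_eqF.
  rewrite -Lx !planar_map_bloch /vec3 /= invc2.
  move: (x ord0) (x 1) (x ord_max) => u p q.
  by case: a b c => [? ?] [? ?] [? ?]; apply: complexP => /=; field.
move=> [[x x1 Lx]|zab].
  set r := x 1 ^+ 2 + x ord_max ^+ 2.
  have r0 : 0 <= r by rewrite addr_ge0 ?sqr_ge0.
  have u1 : r < 1 - x ord0 ^+ 2 by move: x1; rewrite /sqn sum3 /r; lra.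
  pose q := r / (1 - x ord0 ^+ 2).
  have q0 : 0 <= q by rewrite divr_ge0 //; lra.
  have q1 : q < 1 by rewrite ltr_pdivrMr; lra.
  have qr : q * (1 - x ord0 ^+ 2) = r by rewrite divfK //; lra.
  (* The point is in the ellipsoid of equatorial radius [s] as soon as [q <= s^2];
     the mean of [q] and [1] satisfies this and is less than [1]. *)
  pose s := (1 + q) / 2.
  have s0 : 0 < s by rewrite /s; lra.
  have sq : q <= s ^+ 2.
    by rewrite -subr_ge0 (_ : _ - _ = ((1 - q) / 2) ^+ 2) ?sqr_ge0 // /s; field.
  exists (s * d).
    by rewrite /= in_itv /= mulr_gt0 //= gtr_pMl // /s; lra.
  apply/numerical_range_ball.
  exists (vec3 (x ord0) (x 1 / s) (x ord_max / s)).
    rewrite sqn_vec3 -addrA !exprMn -mulrDl -/r exprVn.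
    rewrite -lerBrDl ler_pdivrMr ?exprn_gt0 // mulrC -qr.
    by rewrite ler_wpM2r //; lra.
  have s0' : s != 0 by rewrite gt_eqF.
  rewrite -Lx !planar_map_bloch /vec3 /= invc2.
  clearbody s; move: (x ord0) (x 1) (x ord_max) => u p v.
  by case: a b c => [? ?] [? ?] [? ?]; apply: complexP => /=; field.
have d2 : 0 < d / 2 < d by have := d_gt0; move=> h; apply/andP; split; lra.
exists (d / 2); first by rewrite /= in_itv.
exact/numerical_range_sphere/corner_preimage.
Qed.

End Union.

(** * The elliptical range *)

Section EllipticalRange.
Context {R : realType}.
Variables (a b c : R[i]) (d : R).
Hypothesis d_gt0 : 0 < d.

Local Notation W := (numerical_range (matS a b c d)).
Local Notation E := (rangeE a b c d).
Local Notation m := ((a + b) / 2).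
Local Notation g := (bloch a b c d).
Local Notation T := (image_trace g).
Local Notation P := (image_sqfocus g).
Local Notation Maj := (semi_major a b c d).
Local Notation Min := (semi_minor a b c d).

Lemma trace_bloch_gt : cabs (a - b) ^+ 2 / 4 < T.
Proof.
rewrite trace_bloch; have : 0 < (1 + cabs c ^+ 2) * d ^+ 2.
  by rewrite mulr_gt0 ?exprn_gt0 // ltr_pwDl ?sqr_ge0.
lra.
Qed.

Lemma trace_bloch_gt0 : 0 < T.
Proof. by apply: le_lt_trans trace_bloch_gt; rewrite divr_ge0 ?sqr_ge0. Qed.

Lemma cabs_sqfocus_bloch : cabs P = cabs (discr a b c d) / 4.
Proof.
rewrite sqfocus_bloch ComplexField.Normc.normcM; congr (_ * _).
have -> : (4 : R[i])^-1 = (4^-1)%:C%C by rewrite fmorphV /= rmorph_nat.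
by rewrite cabs_real_ge0.
Qed.

Let axis_sqr (x : R) : 0 <= x -> (1 / (2 * Num.sqrt 2) * Num.sqrt x) ^+ 2 = x / 8.
Proof.
move=> x0; rewrite exprMn sqr_sqrtr // expr_div_n expr1n exprMn sqr_sqrtr //.
by field.
Qed.

Lemma semi_major_ge0 : 0 <= Maj.
Proof. by rewrite !mulr_ge0 ?divr_ge0 ?mulr_ge0 ?sqrtr_ge0. Qed.

Lemma semi_major_sqr : 2 * Maj ^+ 2 = T + cabs P.
Proof.
have T0 := trace_bloch_gt0; rewrite trace_bloch in T0.
rewrite /semi_major axis_sqr ?cabs_sqfocus_bloch ?trace_bloch; first by field.
by have := cabs_ge0 (discr a b c d); lra.
Qed.

Lemma semi_minor_sqr : 2 * Min ^+ 2 = T - cabs P.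
Proof.
have := cabs_sqfocus_le g; rewrite cabs_sqfocus_bloch trace_bloch => h.
by rewrite /semi_minor axis_sqr; [field | lra].
Qed.

Lemma semi_minor_ge0 : 0 <= Min.
Proof. by rewrite !mulr_ge0 ?divr_ge0 ?mulr_ge0 ?sqrtr_ge0. Qed.

Section Foci.
Variable s : R[i].
Hypothesis s2 : s ^+ 2 = discr a b c d.

Let half_sqr : (s / 2) ^+ 2 = P.
Proof. by rewrite sqfocus_bloch -s2; field. Qed.

Let focus1 : (a + b + s) / 2 = m + s / 2. Proof. by field. Qed.
Let focus2 : (a + b - s) / 2 = m - s / 2. Proof. by field. Qed.

Lemma open_ellipse_range z :
  open_ellipse ((a + b + s) / 2) ((a + b - s) / 2) Maj z <->
  cabs ((z - m) ^+ 2 - P) + cabs (z - m) ^+ 2 < T.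
Proof.
rewrite focus1 focus2 -half_sqr; apply: open_ellipseP; first exact: semi_major_ge0.
by rewrite semi_major_sqr half_sqr.
Qed.

(** The elliptical range theorem for the matrices [S_d], including the case of a
  segment. *)
Lemma elliptical_range :
  W = closed_ellipse ((a + b + s) / 2) ((a + b - s) / 2) Maj.
Proof.
rewrite focus1 focus2; apply/seteqP.
have ellE z := closed_ellipseP m (s / 2) Maj T z semi_major_ge0.
rewrite half_sqr semi_major_sqr in ellE.
split => z.
  move=> /numerical_range_ball /(closed_ball_image_criterion g _ trace_bloch_gt0).
  by move=> h; apply/ellE.
move=> /ellE h; apply/numerical_range_ball.
exact/(closed_ball_image_criterion g _ trace_bloch_gt0)/h.
Qed.

Lemma ellipse_data_range :
  ellipse_data ((a + b + s) / 2) ((a + b - s) / 2) Min Maj.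
Proof.
split; [exact: semi_minor_ge0|exact: semi_major_ge0|].
have -> : (a + b + s) / 2 - (a + b - s) / 2 = s by field.
have : cabs s ^+ 2 = 4 * cabs P.
  by rewrite cabs_sqfocus_bloch -s2 !expr2 ComplexField.Normc.normcM; field.
by have := semi_major_sqr; have := semi_minor_sqr; lra.
Qed.

End Foci.

Lemma numerical_range_closed : closed W.
Proof.
rewrite (elliptical_range (sqrtc (discr a b c d)) (sqr_sqrtc _)).
exact: closed_ellipse_closed.
Qed.

Lemma rangeE_sub : E `<=` W.
Proof.
move=> z /(rangeE_ball _ _ _ _ d_gt0) zE; apply/numerical_range_ball.
case: zE => [[x x1 Lx]|/(corner_preimage _ _ c d) [x x1 Lx]].
  by exists x; rewrite // ltW.
by exists x; rewrite ?x1.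
Qed.

(** Shrinking a preimage in the closed ball brings it into the open ball, and moves
  its image a little towards the centre [(a + b) / 2]. *)
Lemma closure_rangeE : closure E = W.
Proof.
apply/seteqP; split.
  rewrite [X in _ `<=` X](closure_id W).1; last exact: numerical_range_closed.
  by apply: closure_subset; exact: rangeE_sub.
move=> z /numerical_range_ball [x x1 Lx] A /(nbhs_line _ (z - m)) [e e01 [_ hA]].
exists (z - e%:C%C * (z - m)); split=> //.
apply/rangeE_ball => //; left; exists (fun i => (1 - e) * x i).
  case/andP: e01 => e0 e1; have := sqn_ge0 x.
  rewrite sqnZ => s0; have : (1 - e) ^+ 2 < 1 by nra.
  nra.
by rewrite planar_mapZ Lx rmorphB rmorph1; ring.
Qed.

(** Removing the first vector [(a - b) / 2] from the family [bloch] leaves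
  [P - w^2 = c d^2] and [T - |w|^2 = (1 + |c|^2) d^2 / 2]. *)
Lemma range_criterion_fst :
  cabs ((a - m) ^+ 2 - P) + cabs (a - m) ^+ 2 =
  T - (1 - cabs c) ^+ 2 * d ^+ 2 / 2.
Proof.
rewrite diagonal_fst sqfocus_bloch trace_bloch.
have -> : ((a - b) / 2) ^+ 2 - discr a b c d / 4 = - (c * (d ^+ 2)%:C%C).
  by rewrite /discr rmorphXn /=; field.
rewrite normcN invc2 !ComplexField.Normc.normcM.
have -> : cabs (d ^+ 2)%:C%C = d ^+ 2.
  by rewrite cabs_real_ge0 ?sqr_ge0.
have -> : cabs (2^-1)%:C%C = 2^-1 :> R.
  by rewrite cabs_real_ge0.
by field.
Qed.

Lemma range_criterion_snd :
  cabs ((b - m) ^+ 2 - P) + cabs (b - m) ^+ 2 =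
  T - (1 - cabs c) ^+ 2 * d ^+ 2 / 2.
Proof.
rewrite -range_criterion_fst diagonal_fst diagonal_snd.
by rewrite sqrrN normcN.
Qed.

Section NonDegenerate.
Hypothesis ndeg : cabs P < T.

Lemma semi_minor_gt0 : 0 < Min.
Proof.
rewrite lt_neqAle semi_minor_ge0 andbT eq_sym; apply/eqP => m0.
by have := semi_minor_sqr; rewrite m0 expr0n /=; move: ndeg; lra.
Qed.

Lemma rangeE_ellipse s : s ^+ 2 = discr a b c d ->
  E = open_ellipse ((a + b + s) / 2) ((a + b - s) / 2) Maj `|` [set a; b].
Proof.
move=> s2; apply/seteqP; split => z.
  move=> /(rangeE_ball _ _ _ _ d_gt0) [/(open_ball_imageP _ ndeg) h|]; last by right.
  by left; apply/open_ellipse_range => //; rewrite -image_form_lt1.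
move=> zE; apply/rangeE_ball => //.
case: zE => [/(open_ellipse_range _ s2)|]; last by right.
by rewrite -image_form_lt1 // => /(open_ball_imageP _ ndeg); left.
Qed.

(** Enlarging the range about its centre takes a point of the ellipse out of it. *)
Lemma interior_range s : s ^+ 2 = discr a b c d ->
  interior W = open_ellipse ((a + b + s) / 2) ((a + b - s) / 2) Maj.
Proof.
move=> s2; apply/seteqP; split; last first.
  rewrite -open_subsetE; last exact: open_ellipse_open.
  by rewrite (elliptical_range s s2) /open_ellipse /closed_ellipse => y /= /ltW.
move=> z /(nbhs_line _ (z - m)) [e /andP[e0 _] [/numerical_range_ball hW _]].
apply/open_ellipse_range => //; rewrite -image_form_lt1 //.
move: hW => /(closed_ball_imageP _ ndeg).
have -> : z + e%:C%C * (z - m) - m = (1 + e)%:C%C * (z - m).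
  by rewrite rmorphD rmorph1; ring.
rewrite image_formZ; set q := image_form _ _ => h.
rewrite ltNge; apply/negP => q1.
have : 1 < (1 + e) ^+ 2 by nra.
nra.
Qed.

(** The ellipse meets the line through its centre perpendicular to the line [a b]. *)
Lemma numerical_range_boundary_point : a <> b ->
  exists z, [/\ W z, ~ interior W z, z <> a & z <> b].
Proof.
move=> ab; pose w1 := a - m.
have w10 : w1 <> 0.
  rewrite /w1 diagonal_fst => h; apply: ab; apply/eqP; rewrite -subr_eq0.
  by rewrite -[a - b](divfK (_ : 2 != 0)) ?h ?mul0r.
have v0 : 'i%C * w1 <> 0.
  move=> /eqP; rewrite mulf_eq0 => /orP[|/eqP//].
  by rewrite eq_complex /= oner_eq0 andbF.
have q0 := image_form_gt0 _ ndeg _ v0; set q := image_form _ _ in q0.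
pose r := (Num.sqrt q)^-1.
have r0 : 0 < r by rewrite invr_gt0 sqrtr_gt0.
have q1 : image_form g (r%:C%C * ('i%C * w1)) = 1.
  by rewrite image_formZ exprVn sqr_sqrtr ?mulVf ?gt_eqF // ltW.
have away (t : R) : 'i%C * w1 * r%:C%C <> t%:C%C * w1.
  rewrite -mulrA [w1 * _]mulrC mulrA => /(mulIf (introN eqP w10)).
  by move=> /(congr1 (@complex.Im R)) /= h; move: r0; rewrite -(_ : 0 = r) ?ltxx //; lra.
exists (m + r%:C%C * ('i%C * w1)).
have wE : m + r%:C%C * ('i%C * w1) - m = r%:C%C * ('i%C * w1) by ring.
split.
- apply/numerical_range_ball; rewrite wE; apply/(closed_ball_imageP _ ndeg).
  by rewrite q1.
- rewrite (interior_range (sqrtc (discr a b c d))) ?sqr_sqrtc //.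
  move=> /(open_ellipse_range _ (sqr_sqrtc _)).
  by rewrite wE -image_form_lt1 // q1 ltxx.
- move=> h; apply: (away 1); rewrite mul1r -/w1.
  by rewrite mulrC -wE h.
- move=> h; apply: (away (-1)); rewrite rmorphN rmorph1 mulN1r.
  by rewrite mulrC -wE h /w1 diagonal_fst diagonal_snd.
Qed.

End NonDegenerate.

(** The points [a] and [b] are no endpoints, since [trace_bloch_gt] says that
  [(a - b) / 2] is shorter than [f]. *)
Lemma rangeE_degenerate f : f ^+ 2 = discr a b c d / 4 -> T = cabs P ->
  E = open_segment (m + f) (m - f).
Proof.
move=> f2 deg.
have Pf : P = f ^+ 2 by rewrite f2 sqfocus_bloch.
have f0 : f <> 0.
  move=> f0; have := trace_bloch_gt0; rewrite deg Pf f0 expr2 mulr0.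
  by rewrite ComplexField.Normc.normc0 ltxx.
have Tff : T = dotc f f by rewrite deg Pf expr2 ComplexField.Normc.normcM -expr2 sqr_cabs.
have segP z : open_segment (m + f) (m - f) z <->
    exists2 t : R, t ^+ 2 < 1 & z - m = t%:C%C * f.
  split.
    move=> [t]; rewrite /= in_itv /= => /andP[t0 t1] <-.
    exists (1 - 2 * t); first by nra.
    by rewrite rmorphB rmorph1 rmorphM rmorph_nat; ring.
  move=> [t t1 zt]; exists ((1 - t) / 2).
    by rewrite /= in_itv /=; apply/andP; split; nra.
  rewrite -[RHS](subrK m) zt invc2 rmorphM rmorphB rmorph1 /=.
  have : (2^-1)%:C%C * 2 = 1 :> R[i] by rewrite -invc2 mulVf.
  move: (2^-1)%:C%C => h h2.
  transitivity ((a + b) * h + f - h * 2 * (1 - t%:C%C) * f); first by ring.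
  by rewrite h2; ring.
have corner : exists2 t : R, t ^+ 2 < 1 & (a - b) / 2 = t%:C%C * f.
  have [t _] := degenerate_ball_image g f f0 Pf deg (vec3 1 0 0).
  rewrite planar_map_pole rmorph1 mul1r => abt; exists t => //.
  have := trace_bloch_gt; rewrite Tff.
  have -> : cabs (a - b) ^+ 2 / 4 = t ^+ 2 * dotc f f.
    have -> : a - b = 2 * (t%:C%C * f) by rewrite -abt; field.
    rewrite sqr_cabs; case: f {f2 Pf f0 Tff segP abt} => p q.
    by rewrite /dotc /=; field.
  by rewrite gtr_pMl // -Tff trace_bloch_gt0.
apply/seteqP; split => z.
  move=> /(rangeE_ball _ _ _ _ d_gt0) [[x x1 zx]|].
    have [t tx Lx] := degenerate_ball_image g f f0 Pf deg x.
    by apply/segP; exists t; rewrite -?zx //; exact: le_lt_trans tx x1.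
  have [t t1 abt] := corner.
  move=> [] ->; apply/segP; [exists t|exists (- t)] => //.
  - by rewrite diagonal_fst.
  - by rewrite sqrrN.
  - by rewrite diagonal_snd abt rmorphN mulNr.
move=> /segP [t t1 zt]; apply/rangeE_ball => //; left.
have [x xt Lx] := degenerate_ball_preimage g f f0 Pf deg t.
by exists x; rewrite ?xt ?Lx ?zt.
Qed.

End EllipticalRange.

(** * The shape of the range in terms of the coefficients *)

Section Discriminant.
Context {R : realType}.
Variables (a b c : R[i]) (d : R).
Hypothesis d_gt0 : 0 < d.

Local Notation T := (image_trace (bloch a b c d)).
Local Notation P := (image_sqfocus (bloch a b c d)).

Lemma cabs_4cd2 : cabs (4 * c * d%:C%C ^+ 2) = 4 * cabs c * d ^+ 2.
Proof.
rewrite -rmorphXn -(rmorph_nat (real_complex R)) /= !ComplexField.Normc.normcM.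
by rewrite !cabs_real_ge0 ?sqr_ge0.
Qed.

Lemma corner_gap : cabs c <> 1 -> 0 < (1 - cabs c) ^+ 2 * d ^+ 2 / 2.
Proof.
move=> c1; rewrite -mulrA pmulr_lgt0; last by rewrite divr_gt0 ?exprn_gt0.
by rewrite exprn_even_gt0 //= subr_eq0 eq_sym; apply/eqP.
Qed.

Lemma nondegenerate_cabs_neq1 : cabs c <> 1 -> cabs P < T.
Proof.
move=> c1; rewrite cabs_sqfocus_bloch trace_bloch.
have tri : cabs (discr a b c d) <= cabs (a - b) ^+ 2 + 4 * cabs c * d ^+ 2.
  rewrite -cabs_4cd2 [cabs (a - b) ^+ 2]expr2 -ComplexField.Normc.normcM -expr2.
  exact: le_normcD.
have := corner_gap c1; lra.
Qed.

Lemma sqr_cabsZD (r : R) (w u : R[i]) : cabs (r%:C%C * w + u) ^+ 2 =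
  r ^+ 2 * cabs w ^+ 2 + 2 * r * dotc u w + cabs u ^+ 2.
Proof.
by rewrite !sqr_cabs; case: w u => [? ?] [? ?]; rewrite /dotc /=; ring.
Qed.

(** The triangle inequality for [discr = (a - b)^2 + 4 c d^2] is strict unless the
  unit number [c] has the direction of [(a - b)^2]. *)
Lemma nondegenerate_noncollinear : a <> b -> cabs c = 1 ->
  c <> (a - b) ^+ 2 / `|a - b| ^+ 2 -> cabs P < T.
Proof.
move=> ab c1 cab; rewrite cabs_sqfocus_bloch trace_bloch c1 expr1n.
rewrite ltr_pM2r ?invr_gt0 //.
set u := (a - b) ^+ 2; set A := cabs (a - b) ^+ 2.
have uA : cabs u = A by rewrite /u expr2 ComplexField.Normc.normcM.
have A0 : 0 < A.
  rewrite lt_neqAle sqr_ge0 andbT eq_sym sqrf_eq0; apply/eqP.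
  by move=> /ComplexField.Normc.eq0_normc /eqP; rewrite subr_eq0 => /eqP.
have dot_lt : dotc u c < A.
  rewrite lt_neqAle; apply/andP; split; last first.
    by have := dotc_le u c; rewrite uA c1 mulr1.
  apply/eqP => uc; apply: cab.
  have : `|a - b| ^+ 2 = A%:C%C by rewrite rmorphXn.
  have A0' : A%:C%C != 0 :> R[i] by rewrite eq_complex /= gt_eqF.
  move=> ->; apply: (canRL (mulfK A0')).
  have : cabs ((- A)%:C%C * c + u) ^+ 2 = 0.
    by rewrite sqr_cabsZD c1 uA uc; ring.
  move=> /eqP; rewrite sqrf_eq0 => /eqP /ComplexField.Normc.eq0_normc /eqP.
  by rewrite rmorphN mulNr addrC subr_eq0 eq_sym mulrC => /eqP.
rewrite -(ltr_pXn2r (n := 2)) ?nnegrE ?cabs_ge0 //; last first.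
  by have := sqr_ge0 d; move: A0; lra.
have -> : discr a b c d = (4 * d ^+ 2)%:C%C * c + u.
  by rewrite rmorphM rmorphXn rmorph_nat /= /discr -/u; ring.
rewrite sqr_cabsZD c1 uA.
have : d ^+ 2 * dotc u c < d ^+ 2 * A by rewrite ltr_pM2l ?exprn_gt0.
lra.
Qed.

Lemma degenerate_collinear : a <> b -> c = (a - b) ^+ 2 / `|a - b| ^+ 2 ->
  discr a b c d = (a - b) ^+ 2 * (1 + 4 * (1 / `|a - b| ^+ 2) * d%:C%C ^+ 2) /\
  T = cabs P.
Proof.
move=> ab ->; set u := (a - b) ^+ 2.
have [A AE] : exists A, A = cabs (a - b) ^+ 2 by exists (cabs (a - b) ^+ 2).
have uA : cabs u = A by rewrite AE /u expr2 ComplexField.Normc.normcM.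
have A0 : 0 < A.
  rewrite AE.
  rewrite lt_neqAle sqr_ge0 andbT eq_sym sqrf_eq0; apply/eqP.
  by move=> /ComplexField.Normc.eq0_normc /eqP; rewrite subr_eq0 => /eqP.
have nA : `|a - b| ^+ 2 = A%:C%C by rewrite AE rmorphXn.
have A0' : A%:C%C != 0 :> R[i] by rewrite eq_complex /= gt_eqF.
have dE : discr a b (u / `|a - b| ^+ 2) d =
    u * (1 + 4 * (1 / `|a - b| ^+ 2) * d%:C%C ^+ 2).
  by rewrite nA /discr -/u; field.
split=> //; rewrite trace_bloch cabs_sqfocus_bloch dE.
have -> : cabs (u / `|a - b| ^+ 2) = 1.
  rewrite nA ComplexField.Normc.normcM ComplexField.Normc.normcV.
  by rewrite cabs_real_ge0 ?(ltW A0) // uA divff ?gt_eqF.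
have -> : 1 + 4 * (1 / `|a - b| ^+ 2) * d%:C%C ^+ 2 = (1 + 4 * d ^+ 2 / A)%:C%C.
  rewrite nA rmorphD rmorphM rmorphM rmorph_nat fmorphV rmorphXn rmorph1 /=.
  by field.
have k0 : 0 <= 1 + 4 * d ^+ 2 / A.
  by rewrite addr_ge0 // divr_ge0 ?(ltW A0) // mulr_ge0 ?sqr_ge0.
rewrite ComplexField.Normc.normcM cabs_real_ge0 //.
by rewrite uA -AE; field; rewrite gt_eqF.
Qed.

End Discriminant.

Theorem theorem3p7 (R : realType) (a b c : R[i]) (d : R) (d_gt0 : 0 < d) :
  let W := numerical_range (matS a b c d) in
  let E := rangeE a b c d in
  closure E = W
  /\ (* (i) *)
  (cabs c <> 1 ->
    [/\ interior W a, interior W b, interior W = E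
      & forall s : R[i], s ^+ 2 = discr a b c d ->
          nondegenerate_open_elliptical_disk E
            ((a + b + s) / 2) ((a + b - s) / 2)
            (semi_minor a b c d) (semi_major a b c d)])
  /\ (* (ii) *)
  (a <> b -> c = (a - b) ^+ 2 / `|a - b| ^+ 2 ->
    let k := 1 / `|a - b| ^+ 2 in
    forall s : R[i], s ^+ 2 = 1 + 4 * k * (d%:C)%C ^+ 2 ->
      E = open_segment ((a + b + (a - b) * s) / 2) ((a + b - (a - b) * s) / 2))
  /\ (* (iii) *)
  (a = b -> cabs c = 1 ->
    forall s : R[i], s ^+ 2 = c ->
      E = open_segment (a + (d%:C)%C * s) (a - (d%:C)%C * s))
  /\ (* (iv) *)
  (a <> b -> cabs c = 1 -> c <> (a - b) ^+ 2 / `|a - b| ^+ 2 ->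
    [/\ boundary W a, boundary W b, E = interior W `|` [set a; b],
        forall s : R[i], s ^+ 2 = discr a b c d ->
          elliptical_disk E
            ((a + b + s) / 2) ((a + b - s) / 2)
            (semi_minor a b c d) (semi_major a b c d)
      & ~ open E /\ ~ closed E]).
Proof.
move=> W E.
have rootP := sqr_sqrtc (discr a b c d).
have clE : closure E = W := closure_rangeE _ _ _ _ d_gt0.
have clW : closure W = W by rewrite -(closure_id _).1 //; exact: numerical_range_closed.
have EW : E `<=` W := rangeE_sub _ _ _ _ d_gt0.
have cornerE : [set a; b] `<=` E by move=> z zab; apply/rangeE_ball => //; right.
have intE : cabs (image_sqfocus (bloch a b c d)) < image_trace (bloch a b c d) ->
    E = interior W `|` [set a; b].
  move=> ndeg; rewrite (interior_range _ _ _ _ d_gt0 ndeg _ rootP).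
  exact: (rangeE_ellipse _ _ _ _ d_gt0 ndeg).
split=> //; split; [|split; [|split]].
- move=> c1; have ndeg := nondegenerate_cabs_neq1 a b c d d_gt0 c1.
  have gap := corner_gap c d d_gt0 c1.
  have ia : interior W a.
    rewrite (interior_range _ _ _ _ d_gt0 ndeg _ rootP).
    apply/(open_ellipse_range _ _ _ _ d_gt0) => //.
    by rewrite range_criterion_fst gtrBl.
  have ib : interior W b.
    rewrite (interior_range _ _ _ _ d_gt0 ndeg _ rootP).
    apply/(open_ellipse_range _ _ _ _ d_gt0) => //.
    by rewrite range_criterion_snd gtrBl.
  have iE : interior W = E.
    rewrite intE //; apply/seteqP; split; first by move=> z; left.
    by move=> z [//|[] ->].
  split=> // s s2; split; first exact: ellipse_data_range.
    exact: semi_minor_gt0.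
  by rewrite -iE; exact: interior_range.
- move=> ab cab k s s2.
  have [dk deg] := degenerate_collinear a b c d ab cab.
  rewrite /E (rangeE_degenerate _ _ _ _ d_gt0 ((a - b) * s / 2)) //.
    by congr open_segment; field.
  by rewrite dk -/k -s2; field.
- move=> ab c1 s s2.
  have deg : image_trace (bloch a b c d) = cabs (image_sqfocus (bloch a b c d)).
    rewrite trace_bloch cabs_sqfocus_bloch /discr ab subrr expr0n add0r cabs_4cd2.
    by rewrite c1 ComplexField.Normc.normc0; ring.
  rewrite /E (rangeE_degenerate _ _ _ _ d_gt0 (d%:C%C * s)) //.
    by rewrite ab; congr open_segment; field.
  by rewrite /discr ab subrr exprMn s2; field.
move=> ab c1 cab.
have ndeg := nondegenerate_noncollinear a b c d d_gt0 ab c1 cab.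
have na : ~ interior W a.
  rewrite (interior_range _ _ _ _ d_gt0 ndeg _ rootP).
  move=> /(open_ellipse_range _ _ _ _ d_gt0 _ rootP).
  by rewrite range_criterion_fst c1 subrr expr0n !mul0r subr0 ltxx.
have nb : ~ interior W b.
  rewrite (interior_range _ _ _ _ d_gt0 ndeg _ rootP).
  move=> /(open_ellipse_range _ _ _ _ d_gt0 _ rootP).
  by rewrite range_criterion_snd c1 subrr expr0n !mul0r subr0 ltxx.
have Ea : E a by apply: cornerE; left.
have Eb : E b by apply: cornerE; right.
have iE := intE ndeg.
split=> //.
- by split=> //; rewrite clW; exact: EW.
- by split=> //; rewrite clW; exact: EW.
- move=> s s2; split; first exact: ellipse_data_range.
    by move=> z zo; rewrite iE (interior_range _ _ _ _ d_gt0 ndeg _ s2); left.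
  by rewrite clE; exact: elliptical_range.
split=> [oE|cE].
  have EiW : E `<=` interior W by rewrite -open_subsetE.
  exact: na (EiW a Ea).
have [z [Wz nz za zb]] := numerical_range_boundary_point _ _ _ _ d_gt0 ndeg ab.
have : E z by rewrite ((closure_id E).1 cE) clE.
by rewrite iE => -[//|[]].
Qed.
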